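(* Let $n \geq 1$ and let $\mathcal F \subset 2^{[n]}$ satisfy $\emptyset \in \mathcal F$ and $[n] \notin \mathcal F$. Then $\|\partial \mathcal F\|_n \geq 1$, and the inequality is strict unless $\mathcal F = \{F \subset [n] : |F| \leq j\}$ for some $0 \leq j < n$.
   Context: $[n]=\{1,\dots,n\}$. For $\mathcal F \subset 2^{[n]}$ the binomial norm is $\|\mathcal F\|_n = \sum_{F \in \mathcal F} 1\big/\binom{n}{|F|}$. The outer boundary of $\mathcal F$ is $\partial \mathcal F = \{G \subset [n] : G \notin \mathcal F,\ \exists F \in \mathcal F \text{ with } |F \triangle G| = 1\}$, where $\triangle$ is symmetric difference. *)

(* Defs.v *)
From mathcomp Require Import all_boot all_order all_algebra.

Set Implicit Arguments.
Unset Strict Implicit.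
Unset Printing Implicit Defensive.

Import Order.TTheory GRing.Theory Num.Theory.
Local Open Scope ring_scope.

(* The ground set {1, ..., n} is modelled by 'I_n = {0, ..., n-1}, so a family
   of subsets of it is a {set {set 'I_n}}. *)

Definition symdiff (T : finType) (A B : {set T}) : {set T} :=
  (A :\: B) :|: (B :\: A).

Definition binorm (n : nat) (F : {set {set 'I_n}}) : rat :=
  \sum_(A in F) ('C(n, #|A|)%:R)^-1.

Definition outer_boundary (n : nat) (F : {set {set 'I_n}}) :
    {set {set 'I_n}} :=
  [set G : {set 'I_n} |
    (G \notin F) && [exists A in F, #|symdiff A G| == 1%N]].

(* Main.v *)
Require Import Defs.
From mathcomp Require Import all_boot all_order all_algebra.

Set Implicit Arguments.
Unset Strict Implicit.
Unset Printing Implicit Defensive.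

Import Order.TTheory GRing.Theory Num.Theory.
Local Open Scope ring_scope.

(** Follow a uniformly random maximal chain from [set0] to the full set until
    it first leaves [F]; it stops in the outer boundary.  A set [A] is the
    stopping point with probability at most [1 / 'C(n, #|A|)], the probability
    that the chain visits [A], so the boundary has norm at least [1].  In case
    of equality no chain reaching a boundary set has left [F] before, so all
    proper subsets of boundary sets lie in [F].  Hence no superset of a boundary
    set lies in [F], the boundary is stable under exchanging an element of a set
    with one outside, and it is a full layer. *)

Lemma exists_superset_card (T : finType) (B : {set T}) (m : nat) :
  (#|B| <= m <= #|T|)%N -> exists2 A : {set T}, B \subset A & #|A| = m.
Proof.
case/andP; elim: m => [|m IHm] leBm lemT.
  by exists B => //; apply/eqP; rewrite -leqn0.
move: leBm; rewrite leq_eqVlt => /orP[/eqP cardB|ltBm]; first by exists B.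
have [A sBA cardA] := IHm ltBm (ltnW lemT).
have /set0Pn[x] : ~: A != set0.
  by rewrite -card_gt0 cardsCs setCK cardA subn_gt0.
rewrite inE => xA; exists (x |: A); last by rewrite cardsU1 xA cardA.
exact: subset_trans sBA (subsetU1 _ _).
Qed.

Lemma exists_subset_card (T : finType) (B : {set T}) (m : nat) :
  (m <= #|B|)%N -> exists2 A : {set T}, A \subset B & #|A| = m.
Proof.
move=> lemB; have lemT : (m <= #|T|)%N := leq_trans lemB (max_card _).
have [|A sBA cardA] := @exists_superset_card T (~: B) (#|T| - m).
  by rewrite leq_subr andbT cardsCs setCK leq_sub2l.
exists (~: A); first by rewrite -setCS setCK.
by rewrite cardsCs setCK cardA subKn.
Qed.

(** The visiting probabilities obey the recursion of [stopped]: a set of size [k.+1] has [k.+1]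
    predecessors, each left for it with probability [1 / (n - k)]. *)
Lemma invr_bin_succ (n k : nat) : (k < n)%N ->
  'C(n, k.+1)%:R^-1 = k.+1%:R * ('C(n, k)%:R^-1 / (n - k)%:R) :> rat.
Proof.
move=> ltkn; have := congr1 (fun i : nat => i%:R : rat) (mul_bin_left n k).
rewrite /= !natrM => Ebin.
have nz1 : k.+1%:R != 0 :> rat by rewrite pnatr_eq0.
have nz2 : (n - k)%:R != 0 :> rat by rewrite pnatr_eq0 subn_eq0 -ltnNge.
have nz3 : 'C(n, k)%:R != 0 :> rat by rewrite pnatr_eq0 -lt0n bin_gt0 ltnW.
by rewrite -invfM [_ * (n - k)%:R]mulrC -Ebin invfM mulrA divff // mul1r.
Qed.

(** The probability that a uniformly random maximal chain passes through [A] at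
    level [k] and all its earlier members lie in [F]. *)
Fixpoint stopped (n : nat) (F : {set {set 'I_n}}) (k : nat) (A : {set 'I_n}) :
    rat :=
  if k is k'.+1 then
    \sum_(y in A) (if A :\ y \in F then stopped F k' (A :\ y) else 0)
                  / (n - k')%:R
  else (A == set0)%:R.

Section Stopped.
Variables (n : nat) (F : {set {set 'I_n}}).
Implicit Types A B : {set 'I_n}.

Lemma stopped_card k A : #|A| != k -> stopped F k A = 0.
Proof.
elim: k A => [|k IHk] A /=; first by rewrite cards_eq0 => /negPf->.
move=> cardA; apply: big1 => y yA; case: ifP => _; last by rewrite mul0r.
by rewrite IHk ?mul0r //; apply: contra cardA; rewrite (cardsD1 y A) yA.
Qed.

(** Only chains standing in [F] continue, and each of them passes on its whole mass, in equal
    shares, to the [n - k] one-element extensions. *)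
Lemma stopped_mass k : (k < n)%N ->
  \sum_A stopped F k.+1 A = \sum_(A in F) stopped F k A.
Proof.
move=> ltkn /=.
pose f A := (if A \in F then stopped F k A else 0) / (n - k)%:R.
have nz : (n - k)%:R != 0 :> rat by rewrite pnatr_eq0 subn_eq0 -ltnNge.
rewrite (exchange_big_dep xpredT) //=.
(* Pairs [y \in A] become pairs [y \notin B] through [B = A :\ y]. *)
transitivity (\sum_(y : 'I_n) \sum_(B : {set 'I_n} | y \notin B) f B).
  apply: eq_bigr => y _.
  rewrite (reindex_onto (fun B => y |: B) (fun A => A :\ y)) /=; last first.
    by move=> A yA; rewrite setD1K.
  apply: eq_big => [B|B /andP[_ /eqP->]//].
  rewrite setU11 /=; apply/eqP/idP => [<-|yB]; first by rewrite !inE eqxx.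
  by rewrite setU1K.
rewrite (exchange_big_dep xpredT) //= [RHS]big_mkcond; apply: eq_bigr => B _.
have -> : \sum_(y | y \notin B) f B = f B *+ #|~: B|.
  by rewrite -sumr_const; apply: eq_bigl => y; rewrite inE.
rewrite /f; case: ifP => _; last by rewrite mul0r mul0rn.
have [cardB|cardB] := eqVneq #|B| k.
  by rewrite cardsCs setCK card_ord cardB -[LHS]mulr_natr divfK.
by rewrite stopped_card // mul0r mul0rn.
Qed.

(** Every maximal chain ends at the full set, hence leaves [F] at exactly one first place. *)
Lemma sum_stopped : [set: 'I_n] \notin F ->
  \sum_(A in ~: F) \sum_(k < n.+1) stopped F k A = 1.
Proof.
move=> FT; rewrite exchange_big /=.
(* Mass stopped before level [m] plus mass arriving at level [m] is the total mass. *)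
have telescope m : (m <= n)%N ->
  \sum_(k < m) \sum_(A in ~: F) stopped F k A + \sum_A stopped F m A = 1.
  elim: m => [|m IHm] lemn.
    rewrite big_ord0 add0r (bigD1 set0) //= eqxx big1 ?addr0 //.
    by move=> A /negPf->.
  rewrite big_ord_recr /= -[RHS](IHm (ltnW lemn)) -addrA; congr (_ + _).
  rewrite (stopped_mass lemn) addrC [RHS](bigID (mem F)) /=; congr (_ + _).
  by apply: eq_bigl => A; rewrite inE.
(* At level [n] only the full set carries mass, and it lies outside [F]. *)
rewrite big_ord_recr /= -[RHS](telescope n) //; congr (_ + _).
rewrite [RHS](bigID (mem (~: F))) /= [X in _ = _ + X]big1 ?addr0 //.
move=> A; rewrite inE negbK => AF; apply: stopped_card.
apply: contraNneq FT => cardA; suff <- : A = setT by [].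
by apply/eqP; rewrite eqEcard subsetT cardsT card_ord cardA leqnn.
Qed.

(** Both sides are sums over the last element [y] added, and are compared term by term by
    induction. *)
Lemma stopped_le k A : #|A| = k ->
  stopped F k A <= 'C(n, #|A|)%:R^-1 ?=
    iff [forall B : {set 'I_n}, (B \proper A) ==> (B \in F)].
Proof.
elim: k A => [|k IHk] A cardA /=.
  have -> : A = set0 by apply/eqP; rewrite -cards_eq0 cardA.
  rewrite eqxx cards0 bin0 invr1; apply/leifP; case: forallP => // - [] B.
  by rewrite properE sub0set andbF.
have ltkn : (k < n)%N by rewrite -cardA -[n in (_ <= n)%N]card_ord max_card.
have cardD y : y \in A -> #|A :\ y| = k.
  by move=> yA; move: cardA; rewrite (cardsD1 y A) yA => -[].
have pos : 0 < (n - k)%:R^-1 :> rat by rewrite invr_gt0 ltr0n subn_gt0.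
have -> : 'C(n, #|A|)%:R^-1 = \sum_(y in A) ('C(n, k)%:R^-1 / (n - k)%:R) :> rat.
  by rewrite sumr_const cardA invr_bin_succ // mulr_natl.
(* [C y] is the equality condition for the summand at [y]. *)
pose C y := (A :\ y \in F) &&
  [forall B : {set 'I_n}, (B \proper A :\ y) ==> (B \in F)].
have -> : [forall B : {set 'I_n}, (B \proper A) ==> (B \in F)]
          = [forall (y | y \in A), C y].
  apply/forall_inP/forall_inP => [H y yA|H B ltBA].
    have ltyA : A :\ y \proper A by rewrite properD1.
    rewrite /C H //=; apply/forall_inP => B ltB.
    exact: H (proper_trans ltB ltyA).
  have /properP[sBA [y yA yB]] := ltBA.
  have /andP[AyF /forall_inP Hy] := H y yA.
  have : B \subset A :\ y by rewrite subsetD1 sBA.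
  by rewrite subEproper => /orP[/eqP->|/Hy].
apply: leif_sum => y yA; have IH := IHk _ (cardD y yA).
rewrite cardD // in IH; rewrite /C.
case: ifP => _ /=.
  by apply/leifP; move/leifP: IH; case: ifP => _; [move/eqP-> | rewrite ltr_pM2r].
(* If [A :\ y] is outside [F], the summand vanishes below a positive bound, so the inequality is
   strict. *)
apply/leifP; rewrite mul0r mulr_gt0 // invr_gt0 ltr0n bin_gt0; exact: ltnW.
Qed.

Lemma setU1_boundary A x : A \in F -> x |: A \notin F ->
  x |: A \in outer_boundary F.
Proof.
move=> AF xAF; rewrite inE xAF; apply/exists_inP; exists A => //.
have xA : x \notin A.
  by apply: contraNN xAF => xA; rewrite (setUidPr _) // sub1set.
apply/cards1P; exists x; apply/setP => z; rewrite !inE.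
by have [->|_] := eqVneq z x; rewrite ?(negPf xA) //=; case: (z \in A).
Qed.

(** A chain counted at [A] either starts there, so [A] is [set0], or comes from a neighbour [A :\ y]
    in [F]. *)
Lemma stopped_boundary k A : set0 \in F -> A \notin F ->
  A \notin outer_boundary F -> stopped F k A = 0.
Proof.
case: k => [|k] F0 AF AD /=.
  by case: eqP AF => // ->; rewrite F0.
apply: big1 => y yA; case: ifP => AyF; last by rewrite mul0r.
by case/negP: AD; rewrite -(setD1K yA) setU1_boundary // setD1K.
Qed.

Lemma binorm_outer_boundary :
  set0 \in F -> [set: 'I_n] \notin F ->
  1 <= binorm (outer_boundary F) ?=
    iff [forall (A | A \in outer_boundary F),
          [forall B : {set 'I_n}, (B \proper A) ==> (B \in F)]].
Proof.
move=> F0 FT; rewrite -(sum_stopped FT) /binorm.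
(* Each [A] carries mass only at level [#|A|], and none if it is outside both [F] and the
   boundary. *)
have -> : \sum_(A in ~: F) \sum_(k < n.+1) stopped F k A =
          \sum_(A in outer_boundary F) stopped F #|A| A.
  rewrite (bigID (mem (outer_boundary F))) /= [X in _ + X]big1 ?addr0.
    apply: eq_big => [A|A _].
      by apply/andP/idP => [[]//|AD]; split=> //; move: AD; rewrite !inE => /andP[].
    have ltA : (#|A| < n.+1)%N.
      by rewrite ltnS -[n in (_ <= n)%N]card_ord max_card.
    rewrite (bigD1 (Ordinal ltA)) //= big1 ?addr0 // => k neqk.
    by apply: stopped_card; rewrite eq_sym.
  move=> A /andP[]; rewrite inE => AF AD; apply: big1 => k _.
  exact: stopped_boundary.
by apply: leif_sum => A _; apply: stopped_le.
Qed.

(** Elements are added to [B] one at a time until [F] is left. *)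
Lemma exists_boundary_superset B : [set: 'I_n] \notin F -> B \in F ->
  exists2 C, C \in outer_boundary F & B \proper C.
Proof.
move=> FT; move: {2}#|~: B| (leqnn #|~: B|) => m.
elim: m B => [|m IHm] B leBm BF.
  case/negP: FT; rewrite -setC0; move: leBm; rewrite leqn0 cards_eq0.
  by move/eqP <-; rewrite setCK.
have /set0Pn[x] : ~: B != set0.
  by apply: contraNneq FT => CB0; rewrite -setC0 -CB0 setCK.
rewrite inE => xB.
have ltB : B \proper x |: B.
  by rewrite properE subsetU1 subUset sub1set (negPf xB).
have [xBF|xBF] := boolP (x |: B \in F).
  have [|//|C CD ltC] := IHm (x |: B); last first.
    by exists C => //; apply: proper_trans ltB ltC.
  by rewrite -ltnS (leq_trans _ leBm) // proper_card // properC.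
by exists (x |: B) => //; apply: setU1_boundary.
Qed.

Hypotheses (F0 : set0 \in F) (FT : [set: 'I_n] \notin F).
(** The equality condition of [binorm_outer_boundary]. *)
Hypothesis FD : forall A B, A \in outer_boundary F -> B \proper A -> B \in F.

(** Otherwise [B], and with it [A], would lie properly below a boundary set, and [FD] would put [A]
    in [F]. *)
Lemma boundary_superset A B :
  A \in outer_boundary F -> A \subset B -> B \notin F.
Proof.
move=> AD sAB; apply/negP => /(exists_boundary_superset FT)[C CD ltBC].
have := FD CD (sub_proper_trans sAB ltBC).
by move: AD; rewrite inE => /andP[/negPf->].
Qed.

Lemma boundary_exchange G x y : G \in outer_boundary F -> x \notin G ->
  y \in G -> x |: (G :\ y) \in outer_boundary F.
Proof.
move=> GD xG yG; have GyF : G :\ y \in F by rewrite (FD GD) ?properD1.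
apply: setU1_boundary => //; apply/negP => G'F.
(* If the exchanged set were in [F], then [x |: G] would be a boundary set properly above [G],
   forcing [G] into [F]. *)
have eqxG : y |: (x |: (G :\ y)) = x |: G by rewrite setUCA setD1K.
have xGD : x |: G \in outer_boundary F.
  by rewrite -eqxG setU1_boundary // eqxG (boundary_superset GD) ?subsetU1.
have ltG : G \proper x |: G.
  by rewrite properE subsetU1 subUset sub1set (negPf xG).
by have := FD xGD ltG; move: GD; rewrite inE => /andP[/negPf->].
Qed.

Lemma boundary_layer G A : G \in outer_boundary F -> #|A| = #|G| ->
  A \in outer_boundary F.
Proof.
move: {2}#|A :\: G| (leqnn #|A :\: G|) => m.
elim: m G => [|m IHm] G leAm GD eqAG.
  move: leAm; rewrite leqn0 cards_eq0 setD_eq0 => sAG.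
  by have /eqP-> : A == G by rewrite eqEcard sAG eqAG leqnn.
have [sAG|nsAG] := boolP (A \subset G).
  by have /eqP-> : A == G by rewrite eqEcard sAG eqAG leqnn.
have /subsetPn[x xA xG] := nsAG.
have /subsetPn[y yG yA] : ~~ (G \subset A).
  apply: contra nsAG => sGA; suff /eqP-> : G == A by [].
  by rewrite eqEcard sGA eqAG leqnn.
(* The exchange removes [x] from [A :\: G] and keeps the size. *)
apply: (IHm (x |: (G :\ y))); last 2 first.
- exact: boundary_exchange.
- by rewrite eqAG cardsU1 !inE (negPf xG) andbF (cardsD1 y G) yG.
rewrite -ltnS (leq_trans _ leAm) // proper_card //; apply/properP; split.
  apply/subsetP => z; rewrite !inE => /andP[+ zA]; rewrite zA andbT.
  rewrite negb_or negb_and negbK => /andP[_ /orP[/eqP zy|//]].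
  by rewrite zy (negPf yA) in zA.
by exists x; rewrite !inE ?xA ?xG ?eqxx.
Qed.

Lemma family_is_ball :
  exists j : nat, (j < n)%N /\ F = [set A : {set 'I_n} | (#|A| <= j)%N].
Proof.
have [G GD ltG] := exists_boundary_superset FT F0.
have G_gt0 : (0 < #|G|)%N by have := proper_card ltG; rewrite cards0.
have leGn : (#|G| <= n)%N by rewrite -[n in (_ <= n)%N]card_ord max_card.
(* The whole layer of size [#|G|] is boundary: smaller sets lie properly below one of its members,
   all others contain one. *)
exists #|G|.-1; split; first by rewrite prednK.
apply/setP => B; rewrite inE -ltnS prednK //; case: ltnP => [ltB|leB].
  have [|A sBA cardA] := @exists_superset_card _ B #|G|.
    by rewrite ltnW // card_ord.
  apply: (FD (boundary_layer GD cardA)).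
  by rewrite properEcard sBA cardA.
have [A sAB cardA] := exists_subset_card leB.
exact/negbTE/(boundary_superset (boundary_layer GD cardA)).
Qed.

End Stopped.

Theorem theorem3p1 (n : nat) (hn : (1 <= n)%N) (F : {set {set 'I_n}})
    (hF0 : set0 \in F) (hFT : [set: 'I_n] \notin F) :
  (1 <= binorm (outer_boundary F)) /\
  (~ (exists j : nat, (j < n)%N /\ F = [set A : {set 'I_n} | (#|A| <= j)%N]) ->
   1 < binorm (outer_boundary F)).
Proof.
have norm_leif := binorm_outer_boundary hF0 hFT.
split=> [|nball]; first by rewrite norm_leif.
rewrite (lt_leif norm_leif); apply/negP => /forall_inP FD; apply: nball.
by apply: family_is_ball => // A B /FD /forall_inP; apply.
Qed.
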